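(* There is an absolute constant $C$ such that for all $\delta,D\ge 1$ there exist parameters $\eta^*>0$ and $\beta^*>1$ (depending only on $\delta,D$) for which the TS-BAL algorithm run with $(\eta,\beta)=(\eta^*,\beta^* )$ is a feasible online policy on all instances satisfying the locally bounded reward assumption with parameters $\delta,D$, and is asymptotically $\Gamma(\delta,D)$-competitive as $c_{\min}:=\min_i c_i\to\infty$, where $$\Gamma(\delta,D)=2\ln(\delta D)+2\ln\ln(\delta\vee D)+C\quad\text{if }\ln(\delta\vee D)\ge e-1,\qquad \Gamma(\delta,D)=C\quad\text{otherwise.}$$
   Context: Notation: $[k]=\{1,\dots,k\}$, $a\vee b=\max(a,b)$, $a\wedge b=\min(a,b)$. Model. There are $n$ servers $[n]$; server $i$ has integer capacity $c_i\ge1$. Jobs $1,\dots,m$ are revealed one at a time in index order, with real arrival times $0\le t_1\le\dots\le t_m$ (jobs with equal arrival times are still revealed one after another). $E\subseteq[n]\times[m]$ is the set of compatible pairs and $\mathcal N(j)=\{i:(i,j)\in E\}$. Each $(i,j)\in E$ has a reward rate $r_{ij}>0$ and a duration $d_{ij}>0$. When job $j$ is revealed (with $t_j$, $\mathcal N(j)$ and $(r_{ij},d_{ij})_{i\in\mathcal N(j)}$), the algorithm must irrevocably assign it to one server in $\mathcal N(j)$ or reject it, without knowledge of later jobs. A job $j$ assigned to $i$ occupies one unit of capacity of $i$ during $[t_j,t_j+d_{ij})$ and yields reward $r_{ij}d_{ij}$. A policy is feasible if for every server $i$ and time $t\ge 0$ the number of jobs $j$ assigned to $i$ with $t_j\le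 t<t_j+d_{ij}$ is at most $c_i$. $\mathrm{ALG}(I)$ is the total reward collected by the algorithm on instance $I$; $\mathrm{OPT}(I)$ is the maximum total reward of a feasible (integral) assignment computed with full knowledge of $I$. Locally bounded reward assumption (parameters $\delta,D\ge1$, known to the algorithm): $1\le d_{ij}\le D$ for all $(i,j)\in E$; and $1/\delta\le r_{ij}/r_{ij'}\le\delta$ whenever $i\in\mathcal N(j)\cap\mathcal N(j')$ and $|t_j-t_{j'}|\le D$. $\mathcal I(\delta,D,\{c_i\})$ is the set of all finite instances satisfying it with server capacities $\{c_i\}_{i\in[n]}$. An online algorithm is asymptotically $\Gamma$-competitive if $\limsup_{\min_i c_i\to\infty}\ \sup_{I\in\mathcal I(\delta,D,\{c_i\})}\mathrm{OPT}(I)/\mathbb E[\mathrm{ALG}(I)]\le\Gamma$ (instances with $\mathrm{OPT}(I)=0$ are disregarded). BALANCE framework. Given losses $\mathcal L_{ij}$, when job $j$ arrives: if $\max_{i\in\mathcal N(j)}\{r_{ij}d_{ij}-\mathcal L_{ij}\}>0$, assign $j$ to a server attaining this maximum; otherwise leave $j$ unassigned. TS-BAL. Let $\Psi(x)=\eta(\beta^{1-x}-1)$ with $\eta>0,\beta>1$. For $T_1<T_2$, a reuse schedule over $[T_1,T_2)$ is a finite (possibly empty) sequence $T_1\le\tau_1<\dots<\tau_s<T_2$ with $\tau_{z+1}-\tau_z\ge1$ for all $z$; $\mathfrak S[T_1,T_2)$ is the set of these. For $(i,j)\in E$ and $t\in[t_j,t_j+D)$, $\hat r_{i,j,t}=\min\{r_{ik}: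 k\le j,\ i\in\mathcal N(k),\ t_k\ge t-D\}$. For a job $k$ and $\tau\ge t_k$, $\alpha_{i,k\to\tau}=1-\frac1{c_i}\#\{h\le k: h \text{ is assigned to } i \text{ and } t_h+d_{ih}>\tau\}$, and $\alpha_{i,0\to\tau}=1$. TS-BAL is the BALANCE framework with $$\mathcal L_{ij}=\mathcal L^{\mathrm{TS}}_{ij}=\max_{\boldsymbol\tau\in\mathfrak S[t_j,t_j+d_{ij})}\sum_{\tau\in\boldsymbol\tau}\hat r_{i,j,\tau}\Psi(\alpha_{i,j-1\to\tau}).$$ *)

(* Defs.v *)
From mathcomp Require Import all_boot all_order all_algebra.
From mathcomp Require Import all_classical all_reals all_analysis.
Set Implicit Arguments.
Unset Strict Implicit.
Unset Printing Implicit Defensive.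
Import Order.TTheory GRing.Theory Num.Theory.
Import numFieldNormedType.Exports.
Local Open Scope classical_set_scope.
Local Open Scope ring_scope.

(* A job as it is revealed; [rate] and [dur] matter only on [compat]. *)
Record job (R : realType) (n : nat) := Job {
  arrival : R;
  compat : {set 'I_n};
  rate : 'I_n -> R;
  dur : 'I_n -> R }.

(* Jobs in order of revelation; the capacities are kept separate. *)
Definition instance (R : realType) (n : nat) := seq (job R n).

Definition valid_instance (R : realType) (n : nat) (I : instance R n) : bool :=
  [&& all (fun j => 0 <= arrival j) I,
      sorted <=%R (map (@arrival R n) I)
    & all (fun j => [forall i in compat j, (0 < rate j i) && (0 < dur j i)]) I].

Definition locally_bounded (R : realType) (n : nat) (delta D : R)
    (I : instance R n) : bool :=
  all (fun j => [forall i in compat j, 1 <= dur j i <= D]) I &&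
  all2rel (fun j j' =>
    (`|arrival j - arrival j'| <= D) ==>
    [forall i in compat j :&: compat j',
       delta^-1 <= rate j i / rate j' i <= delta]) I.

(* The set I(delta, D, {c_i}); it does not depend on the values c_i. *)
Definition instances (R : realType) (n : nat) (delta D : R) :
    set (instance R n) :=
  [set I | valid_instance I /\ locally_bounded delta D I].

(* Revealed jobs in order, each with its decision (None = rejected). *)
Definition history (R : realType) (n : nat) := seq (job R n * option 'I_n).

Definition active (R : realType) (n : nat) (i : 'I_n) (t : R)
    (x : job R n * option 'I_n) : bool :=
  (x.2 == Some i) && (arrival x.1 <= t < arrival x.1 + dur x.1 i).

Definition feasible (R : realType) (n : nat) (c : 'I_n -> nat)
    (h : history R n) : Prop :=
  all (fun x => if x.2 is Some i then i \in compat x.1 else true) h /\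
  forall (i : 'I_n) (t : R), 0 <= t -> (count (active i t) h <= c i)%N.

Definition reward (R : realType) (n : nat) (h : history R n) : R :=
  \sum_(x <- h) if x.2 is Some i then rate x.1 i * dur x.1 i else 0.

(* The default 0 is the reward of rejecting every job. *)
Definition opt (R : realType) (n : nat) (c : 'I_n -> nat)
    (I : instance R n) : R :=
  \big[Num.max/0]_(a : (size I).-tuple (option 'I_n) | `[< feasible c (zip I a) >])
    reward (zip I a).

(* A deterministic online rule, for any number of servers: capacities, past
   jobs with the decisions taken, and current job, to the current decision. *)
Definition rule (R : realType) :=
  forall n : nat, ('I_n -> nat) -> history R n -> job R n -> option 'I_n.

Definition run (R : realType) (n : nat) (f : rule R) (c : 'I_n -> nat)
    (I : instance R n) : history R n :=
  foldl (fun h j => rcons h (j, f n c h j)) [::] I.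

(* A randomized online algorithm is a random rule. *)
Record online_algorithm (R : realType) := OnlineAlgorithm {
  seed_display : measure_display;
  seed : measurableType seed_display;
  seed_law : probability seed R;
  act : seed -> rule R;
  measurable_act : forall (n : nat) (c : 'I_n -> nat) (h : history R n)
    (j : job R n) (o : option 'I_n), measurable [set w | act w c h j = o] }.

Definition expected_alg (R : realType) (n : nat) (A : online_algorithm R)
    (c : 'I_n -> nat) (I : instance R n) : \bar R :=
  (\int[seed_law A]_w (reward (run (act w) c I))%:E)%E.

Definition feasible_policy (R : realType) (delta D : R)
    (A : online_algorithm R) : Prop :=
  forall (n : nat) (c : 'I_n -> nat), (forall i, (1 <= c i)%N) ->
  forall I : instance R n, instances delta D I ->
  forall w : seed A, feasible c (run (act w) c I).

(* In \bar R, x / 0 = +oo for x > 0. *)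
Definition worst_ratio (R : realType) (n : nat) (delta D : R)
    (A : online_algorithm R) (c : 'I_n -> nat) : \bar R :=
  ereal_sup [set ((opt c I)%:E / expected_alg A c I)%E
            | I in [set I : instance R n | instances delta D I /\ opt c I != 0]].

(* The upper limit as min_i c_i --> oo is taken over all capacity families,
   whatever the number n of servers. *)
Definition asymptotic_ratio (R : realType) (delta D : R)
    (A : online_algorithm R) : \bar R :=
  ereal_inf (range (fun c0 : nat =>
    ereal_sup [set worst_ratio delta D A (projT2 nc)
              | nc in [set nc : {n : nat & 'I_n -> nat} |
                         forall i, (c0 <= projT2 nc i)%N]])).

Definition asymptotically_competitive (R : realType) (delta D Gamma : R)
    (A : online_algorithm R) : Prop :=
  (asymptotic_ratio delta D A <= Gamma%:E)%E.

(* Ties may be broken arbitrarily. *)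
Definition balance_choice (R : realType) (n : nat) (L : 'I_n -> R)
    (j : job R n) (o : option 'I_n) : Prop :=
  match o with
  | Some i => [/\ i \in compat j, 0 < rate j i * dur j i - L i &
      forall k, k \in compat j -> rate j k * dur j k - L k <= rate j i * dur j i - L i]
  | None => forall k, k \in compat j -> rate j k * dur j k - L k <= 0
  end.

Definition Psi (R : realType) (eta beta x : R) : R :=
  eta * (beta `^ (1 - x) - 1).

Definition reuse_schedule (R : realType) (T1 T2 : R) (s : seq R) : bool :=
  sorted (fun x y => x + 1 <= y) s && all (fun tau => T1 <= tau < T2) s.

(* For t < t_j + D the current job j itself belongs to the range of the
   minimum, so that taking its rate as the default value is harmless. *)
Definition rhat (R : realType) (n : nat) (D : R) (h : history R n)
    (j : job R n) (i : 'I_n) (t : R) : R :=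
  \big[Num.min/rate j i]_(x <- h | (i \in compat x.1) && (t - D <= arrival x.1))
    rate x.1 i.

Definition alpha (R : realType) (n : nat) (c : 'I_n -> nat) (h : history R n)
    (i : 'I_n) (t : R) : R :=
  1 - (count (fun x => (x.2 == Some i) && (t < arrival x.1 + dur x.1 i)) h)%:R
      / (c i)%:R.

Definition schedule_value (R : realType) (n : nat) (D eta beta : R)
    (c : 'I_n -> nat) (h : history R n) (j : job R n) (i : 'I_n)
    (s : seq R) : R :=
  \sum_(tau <- s) rhat D h j i tau * Psi eta beta (alpha c h i tau).

(* The supremum is attained, see [ts_loss_max]. *)
Definition ts_loss (R : realType) (n : nat) (D eta beta : R)
    (c : 'I_n -> nat) (h : history R n) (j : job R n) (i : 'I_n) : R :=
  sup [set schedule_value D eta beta c h j i s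
      | s in [set s | reuse_schedule (arrival j) (arrival j + dur j i) s]].

Definition ts_bal (R : realType) (D eta beta : R) (A : online_algorithm R) : Prop :=
  forall (w : seed A) (n : nat) (c : 'I_n -> nat) (h : history R n) (j : job R n),
    balance_choice (ts_loss D eta beta c h j) j (act w c h j).

Definition Gamma (R : realType) (C delta D : R) : R :=
  if expR 1 - 1 <= ln (Num.max delta D)
  then 2 * ln (delta * D) + 2 * ln (ln (Num.max delta D)) + C
  else C.

Lemma schedule_size (R : realType) (T1 T2 : R) (s : seq R) :
  reuse_schedule T1 T2 s -> (size s)%:R <= Num.max 0 (T2 - T1) + 1.
Proof.
case: s => [|x s]; first by rewrite addr_ge0// le_max lexx.
rewrite /reuse_schedule => /andP[xs /allP sT].
suff xl : x + (size s)%:R <= last x s.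
  have /andP[T1x _] := sT x (mem_head _ _).
  have /andP[_ lT2] := sT _ (mem_last x s).
  rewrite /= -natr1 lerD2r le_max; apply/orP; right.
  by rewrite lerBrDl (le_trans _ (le_trans xl (ltW lT2)))// lerD2r.
elim: s x xs {sT} => [|y s IH] x /=; first by rewrite addr0.
move=> /andP[xy ys]; apply: le_trans (IH y ys).
by rewrite -nat1r addrA lerD2r.
Qed.

Lemma finite_max (R : realType) (V : set R) : finite_set V -> V !=set0 ->
  exists2 x, V x & forall y, V y -> y <= x.
Proof.
move=> /finite_seqP[s ->] [x /= xs].
exists (\big[Num.max/x]_(y <- s) y); last first.
  by move=> y ys; exact: (le_bigmax_seq _ y xpredT id).
rewrite /= big_seq; apply: (big_ind (fun y => y \in s)) => //.
by move=> a b as_ bs; rewrite /Num.max; case: ifP.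
Qed.

Lemma ts_loss_max (R : realType) (n : nat) (D eta beta : R)
    (c : 'I_n -> nat) (h : history R n) (j : job R n) (i : 'I_n) :
  exists s,
    [/\ reuse_schedule (arrival j) (arrival j + dur j i) s,
        ts_loss D eta beta c h j i = schedule_value D eta beta c h j i s &
        forall s', reuse_schedule (arrival j) (arrival j + dur j i) s' ->
          schedule_value D eta beta c h j i s'
            <= schedule_value D eta beta c h j i s].
Proof.
pose f tau := rhat D h j i tau * Psi eta beta (alpha c h i tau).
have ff : finite_set (range f).
  pose V1 : set R := [set` rate j i :: map (fun x => rate x.1 i) h].
  pose V2 : set R := [set Psi eta beta (1 - k%:R / (c i)%:R) | k in `I_(size h).+1].
  apply: (@sub_finite_set _ _ [set x * y | x in V1 & y in V2]); last first.
    by apply: finite_image2; [exact: finite_seq|exact/finite_image/finite_II].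
  move=> _ [t _ <-]; exists (rhat D h j i t).
    rewrite /rhat /V1 /=.
    elim: h {V1 V2 f} => [|x h IH]; first by rewrite big_nil mem_head.
    have sub a : a \in rate j i :: map (fun x => rate x.1 i) h ->
        a \in rate j i :: map (fun x => rate x.1 i) (x :: h).
      by rewrite /= !inE => /orP[->//|->]; rewrite !orbT.
    rewrite big_cons; case: ifP => _; last exact: sub.
    by rewrite /Num.min; case: ifP => _; [rewrite !inE eqxx orbT|exact: sub].
  exists (Psi eta beta (alpha c h i t)) => //.
  by eexists; last reflexivity; rewrite /= ltnS count_size.
pose fix W k : set R := if k is k'.+1 then [set x + y | x in range f & y in W k'] else [set 0].
have fW k : finite_set (W k).
  by elim: k => [|k IH] /=; [exact: finite_set1|exact: finite_image2].
have sW s : W (size s) (\sum_(t <- s) f t).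
  elim: s => [|x s IH] /=; first by rewrite big_nil.
  by rewrite big_cons; exists (f x); [exists x|exists (\sum_(t <- s) f t)].
pose T1 := arrival j; pose T2 := T1 + dur j i.
pose N := (Num.truncn (Num.max 0 (T2 - T1) + 1)).+1.
pose S := [set schedule_value D eta beta c h j i s
      | s in [set s | reuse_schedule T1 T2 s]].
have fS : finite_set S.
  apply: (@sub_finite_set _ _ (\bigcup_(k in `I_N) W k)); last first.
    by apply: bigcup_finite => //; exact: finite_II.
  move=> _ [s ss <-]; exists (size s); last exact: sW.
  have := schedule_size ss => /le_lt_trans/(_ (truncnS_gt _)).
  by rewrite /= ltr_nat.
have S0 : S !=set0 by exists 0, [::]; rewrite /schedule_value ?big_nil.
have [_ [s ss <-] smax] := finite_max fS S0.
exists s; split => //; last by move=> s' ss'; apply: smax; exists s'.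
apply/eqP; rewrite eq_le; apply/andP; split.
  by apply: ge_sup => // y; exact: smax.
apply: ub_le_sup; last by exists s.
by exists (schedule_value D eta beta c h j i s) => y; exact: smax.
Qed.

(* Main.v *)
(* Write X = delta * D, and choose beta with eta * (beta - 1) = X: then the loss on
   a full server is at least the reward, so capacities are never exceeded.

   For the ratio, bound the reward of each job k that the optimum gives to a server
   i by the net value (reward minus loss) that the algorithm gains on k, plus the
   loss L of (i, k). As Psi + eta is exponential in the occupancy, c_i times L is
   a sum, over the earlier jobs h of the algorithm on i and the times of the
   optimal reuse schedule of k before h ends, of shifted prices as seen by h,
   multiplied by kappa = c_i (beta^(1/c_i) - 1), which tends to ln beta. For fixed
   h, the schedules of the later optimal jobs on i fall into 2 c_i classes whose
   concatenations are reuse schedules during h, because the optimal jobs can be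
   split into 2 c_i sequences with gaps of length at least 1; hence each class
   contributes at most the loss of h plus eta * rate * (dur + 1). Altogether
   OPT <= (1 + 2 kappa (1 + 2 eta)) ALG, and eta = 1 / ln X gives the bound. *)
Require Import Defs.
From mathcomp Require Import all_boot all_order all_algebra.
From mathcomp Require Import all_classical all_reals all_analysis.
From mathcomp Require Import lra ring.
Set Implicit Arguments.
Unset Strict Implicit.
Unset Printing Implicit Defensive.
Import Order.TTheory GRing.Theory Num.Theory.
Local Open Scope ring_scope.

(** * Splitting intervals into classes and packing schedules *)

(** Greedy assignment in list order: fewer than [N] predecessors conflict with [x], so some class
    contains none of them and can take [x]. *)
Lemma first_fit (T : eqType) (e : rel T) (N : nat) (s : seq T) :
  (forall s1 x s2, s = rcons s1 x ++ s2 ->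
     (count (fun y => ~~ e y x) s1 < N)%N) ->
  exists F : 'I_N -> seq T,
    (forall k, pairwise e (F k)) /\ perm_eq (flatten [seq F k | k <- enum 'I_N]) s.
Proof.
have cntE (G : 'I_N -> seq T) p :
    count p (flatten [seq G k | k <- enum 'I_N]) = (\sum_k count p (G k))%N.
  by rewrite count_flatten -map_comp sumnE big_map big_enum.
elim/last_ind: s => [_|s x IH sN].
  exists (fun=> [::]); split => //.
  by apply/permP => p; rewrite cntE big1.
have [|F [eF Fs]] := IH.
  by move=> s1 y s2 sE; apply: (sN s1 y (rcons s2 x)); rewrite sE rcons_cat.
have := sN s x [::] (esym (cats0 _)).
rewrite -(permP Fs) cntE => FN.
have [k0 /eqP k0x] : exists k0, count (fun y => ~~ e y x) (F k0) == 0%N.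
  apply/existsP; apply: contraTT FN; rewrite negb_exists -leqNgt => /forallP k0.
  rewrite -[X in (X <= _)%N]card_ord -sum1_card; apply: leq_sum => k _.
  by rewrite lt0n k0.
exists (fun k => if k == k0 then rcons (F k) x else F k); split=> [k|].
  have [->|_] := eqVneq k k0; last exact: eF.
  rewrite pairwise_rcons eF andbT.
  move/eqP: k0x; rewrite eqn0Ngt -has_count -all_predC => /allP ke.
  by apply/allP => y /ke /=; rewrite negbK.
apply/permP => p; rewrite cntE -cats1 count_cat -(permP Fs) cntE.
rewrite (bigD1 k0)//= eqxx -cats1 count_cat [in RHS](bigD1 k0)//= addn0 addnAC.
by congr (_ + _ + _)%N; apply: eq_bigr => k /negPf ->.
Qed.

(* Enlarging every interval by [1] on the right at most doubles the overlap,
   since an interval ending in ]t - 1, t] has length at least [1], hence contains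
   [t - 1]. *)
Lemma interval_classes (R : realType) (T : eqType) (a b : T -> R) (c : nat)
    (s : seq T) :
  sorted (fun x y => a x <= a y) s ->
  {in s, forall x, 0 <= a x /\ a x + 1 <= b x} ->
  (forall t : R, 0 <= t -> (count (fun x => a x <= t < b x)%R s <= c)%N) ->
  exists F : 'I_(2 * c) -> seq T,
    (forall k, pairwise (fun x y => b x + 1 <= a y) (F k)) /\
    perm_eq (flatten [seq F k | k <- enum 'I_(2 * c)]) s.
Proof.
move=> s_sorted sab sc; apply: first_fit => s1 x s2 sE.
have xs : x \in s by rewrite sE mem_cat mem_rcons mem_head.
have [ax0 abx] := sab x xs.
have sub1 y : y \in s1 -> y \in s.
  by move=> ys; rewrite sE mem_cat mem_rcons inE ys orbT.
have le1 y : y \in s1 -> a y <= a x.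
  move=> ys; move: s_sorted.
  rewrite sorted_pairwise; last by move=> u v w; exact: le_trans.
  by rewrite sE pairwise_cat pairwise_rcons => /and3P[_ /andP[/allP/(_ _ ys)]].
(* Strict, because [x] itself occupies time [a x]. *)
have c1 : (count (fun y => a y <= a x < b y)%R s1 < c)%N.
  have := sc _ ax0; rewrite sE count_cat -cats1 count_cat /= lexx.
  rewrite (lt_le_trans _ abx) ?ltrDl//=; apply: leq_trans.
  by rewrite addn0 addn1 leq_addr.
(* Capacity is only controlled at nonnegative times. If [a x < 1], every earlier interval, having
   length at least 1, still contains [a x] and is counted in [c1]. *)
have c2 : (count (fun y => (a y <= a x - 1 < b y) && (0 <= a x - 1))%R s1 <= c)%N.
  have [ax1|ax1] := leP 0 (a x - 1); last first.
    by rewrite (eq_count (a2 := pred0)) ?count_pred0// => y; rewrite andbF.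
  apply: leq_trans (sc _ ax1); rewrite sE count_cat -cats1 count_cat -addnA.
  rewrite (eq_count (a2 := fun y => a y <= a x - 1 < b y)) ?leq_addr// => y.
  by rewrite andbT.
have sub_cnt (p q : pred T) : {in s1, subpred p q} -> (count p s1 <= count q s1)%N.
  move=> pq; rewrite (@eq_in_count _ p (predI p q)).
    by apply: sub_count => y /andP[].
  by move=> y ys /=; case: (boolP (p y)) => //= /(pq y ys) ->.
have := leq_add c1 c2; rewrite addSn -[X in (X < _)%N]count_predUI.
rewrite mul2n -addnn; apply: leq_trans; apply: leq_trans (leq_addr _ _).
apply: sub_cnt => y ys /=; rewrite -ltNge => axy.
have [ay0 aby] := sab y (sub1 y ys); rewrite (le1 y ys)/=.
have [//|bx] := ltP (a x) (b y).
by apply/andP; split; [apply/andP; split|]; lra.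
Qed.

(** Inside one class the intervals are at least 1 apart, so their schedules, cut at [T2],
    concatenate to a single reuse schedule over [[T1, T2)], of value at most [M]. *)
Lemma packing (R : realType) (T : eqType) (a b : T -> R) (c : nat) (s : seq T)
    (sch : T -> seq R) (g : R -> R) (T1 T2 M : R) :
  sorted (fun x y => a x <= a y) s ->
  {in s, forall x, 0 <= a x /\ a x + 1 <= b x} ->
  (forall t : R, 0 <= t -> (count (fun x => a x <= t < b x)%R s <= c)%N) ->
  {in s, forall x, T1 <= a x /\ reuse_schedule (a x) (b x) (sch x)} ->
  (forall s', reuse_schedule T1 T2 s' -> \sum_(t <- s') g t <= M) ->
  \sum_(x <- s) \sum_(t <- sch x | t < T2) g t <= (2 * c)%:R * M.
Proof.
move=> s_sorted sab sc ssch gM.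
have [F [Fab Fs]] := interval_classes s_sorted sab sc.
rewrite -(perm_big _ Fs) big_flatten big_map big_enum.
have le1_trans : transitive (fun x y : R => x + 1 <= y).
  by move=> y x z xy yz; lra.
suff FM k : \sum_(x <- F k) \sum_(t <- sch x | t < T2) g t <= M.
  by apply: le_trans (ler_sum _ (fun k _ => FM k)) _; rewrite sumr_const card_ord mulr_natl.
have {}ssch : {in F k, forall x, T1 <= a x /\ reuse_schedule (a x) (b x) (sch x)}.
  move=> x xF; apply: ssch; rewrite -(perm_mem Fs).
  by apply/flatten_mapP; exists k; rewrite ?mem_enum.
pose l := flatten [seq [seq t <- sch x | t < T2] | x <- F k].
have -> : \sum_(x <- F k) \sum_(t <- sch x | t < T2) g t = \sum_(t <- l) g t.
  by rewrite big_flatten big_map; apply: eq_bigr => x _; rewrite big_filter.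
apply: gM; rewrite /reuse_schedule sorted_pairwise//; apply/andP; split.
  rewrite /l; have := Fab k; elim: (F k) ssch => [//|x r IH] ssch /= /andP[xr rr].
  have [_ /andP[sx /allP sxab]] := ssch x (mem_head _ _).
  rewrite pairwise_cat IH//; last by move=> y yr; apply: ssch; rewrite inE yr orbT.
  rewrite -sorted_pairwise// sorted_filter// !andbT.
  apply/allrelP => u v; rewrite mem_filter => /andP[_ /sxab /andP[_ ub]].
  move=> /flatten_mapP[y yr]; rewrite mem_filter => /andP[_ vy].
  have [|_ /andP[_ /allP/(_ v vy)/andP[yv _]]] := ssch y; first by rewrite inE yr orbT.
  by have := allP xr y yr; lra.
apply/allP => t /flatten_mapP[x xF]; rewrite mem_filter => /andP[-> tx].
have [ax /andP[_ /allP/(_ t tx)/andP[at_ _]]] := ssch x xF.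
by rewrite andbT (le_trans ax at_).
Qed.

(** * Indexed histories, prices and losses *)

(** Indexing by position lets the algorithm and the optimum share one job sequence and gives all
    prefixes the same form. *)
Definition hist (R : realType) (n : nat) (j : nat -> job R n)
    (o : nat -> option 'I_n) (k : nat) : history R n :=
  [seq (j h, o h) | h <- iota 0 k].

(** Only the half of the rate assumption that compares a later job with an earlier one is kept; it
    bounds [rhat] from below. *)
Definition bounded_jobs (R : realType) (n : nat) (delta D : R)
    (j : nat -> job R n) (m : nat) : Prop :=
  [/\ forall k, (k < m)%N -> 0 <= arrival (j k),
      forall h k, (h <= k)%N -> (k < m)%N -> arrival (j h) <= arrival (j k),
      forall k i, (k < m)%N -> i \in compat (j k) ->
        0 < rate (j k) i /\ 1 <= dur (j k) i <= D &
      forall h k i, (h <= k)%N -> (k < m)%N ->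
        i \in compat (j h) -> i \in compat (j k) ->
        arrival (j k) - D <= arrival (j h) ->
        rate (j k) i <= delta * rate (j h) i].

Definition occupies (R : realType) (n : nat) (j : nat -> job R n)
    (o : nat -> option 'I_n) (i : 'I_n) (t : R) (h : nat) : bool :=
  (o h == Some i) && (t < arrival (j h) + dur (j h) i).

Lemma alpha_hist (R : realType) (n : nat) (c : 'I_n -> nat) (j : nat -> job R n)
    (o : nat -> option 'I_n) (i : 'I_n) (t : R) (k : nat) :
  alpha c (hist j o k) i t =
  1 - (count (occupies j o i t) (iota 0 k))%:R / (c i)%:R.
Proof. by rewrite /alpha count_map. Qed.

Lemma rhat_hist (R : realType) (n : nat) (D : R) (j : nat -> job R n)
    (o : nat -> option 'I_n) (i : 'I_n) (t : R) (k : nat) :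
  rhat D (hist j o k) (j k) i t =
  \big[Num.min/rate (j k) i]_(h <- iota 0 k
    | (i \in compat (j h)) && (t - D <= arrival (j h))) rate (j h) i.
Proof. by rewrite /rhat big_map. Qed.

Lemma schedule_value_le_loss (R : realType) (n : nat) (D eta beta : R)
    (c : 'I_n -> nat) (h : history R n) (j : job R n) (i : 'I_n) (s : seq R) :
  reuse_schedule (arrival j) (arrival j + dur j i) s ->
  schedule_value D eta beta c h j i s <= ts_loss D eta beta c h j i.
Proof. by have [s' [_ -> smax]] := ts_loss_max D eta beta c h j i; exact: smax. Qed.

Lemma ts_loss_ge0 (R : realType) (n : nat) (D eta beta : R)
    (c : 'I_n -> nat) (h : history R n) (j : job R n) (i : 'I_n) :
  0 <= ts_loss D eta beta c h j i.
Proof.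
rewrite (le_trans _ (schedule_value_le_loss D eta beta c h (s := [::]) _))//.
by rewrite /schedule_value big_nil.
Qed.

(** The shift makes the price purely exponential in the occupancy. It costs at most [eta * rate] per
    point, and a schedule has at most [dur + 1] points. *)
Lemma schedule_shifted_value_le (R : realType) (n : nat) (D eta beta : R)
    (c : 'I_n -> nat) (h : history R n) (j : job R n) (i : 'I_n) (s : seq R) :
  0 <= eta -> 0 <= rate j i -> 0 <= dur j i ->
  reuse_schedule (arrival j) (arrival j + dur j i) s ->
  \sum_(t <- s) rhat D h j i t * (Psi eta beta (alpha c h i t) + eta) <=
  ts_loss D eta beta c h j i + eta * (rate j i * (dur j i + 1)).
Proof.
move=> eta0 r0 d0 ss.
under eq_bigr do rewrite mulrDr.
rewrite big_split; apply: lerD; first exact: schedule_value_le_loss.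
have le_r t : rhat D h j i t * eta <= eta * rate j i.
  by rewrite mulrC ler_wpM2l// bigmin_le_id.
apply: le_trans (ler_sum _ (fun t _ => le_r t)) _.
rewrite big_const_seq count_predT iter_addr_0 -mulr_natr -mulrA.
rewrite !ler_wpM2l// (le_trans (schedule_size ss))//.
by rewrite addrAC subrr add0r max_r.
Qed.

(* A geometric sum: [Psi + eta] is multiplied by [beta `^ (1 / c)] each time a
   job occupies the server. *)
Lemma Psi_telescope (R : realType) (eta beta : R) (c : nat) (P : pred nat)
    (k : nat) : 0 < beta ->
  Psi eta beta (1 - (count P (iota 0 k))%:R / c%:R) =
  (beta `^ c%:R^-1 - 1) *
    \sum_(0 <= h < k | P h) (Psi eta beta (1 - (count P (iota 0 h))%:R / c%:R) + eta).
Proof.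
move=> beta0; have PsiE q : Psi eta beta (1 - q / c%:R) = eta * (beta `^ (q / c%:R) - 1).
  by rewrite /Psi subKr.
elim: k => [|k IH].
  by rewrite big_nil mulr0 PsiE mul0r powRr0 subrr mulr0.
rewrite -[in LHS]addn1 iotaD add0n count_cat big_mkcond big_nat_recr// -big_mkcond.
rewrite [in RHS]mulrDr -IH /= addn0 !PsiE natrD mulrDl.
case: (P k) => /=; last by rewrite mul0r addr0 mulr0 addr0.
rewrite powRD; last by rewrite (gt_eqF beta0) implybT.
by rewrite div1r; ring.
Qed.

(** The minimum for [k] runs over a larger set: the window condition makes [h] itself eligible,
    which covers the default value on the right. *)
Lemma rhat_hist_le (R : realType) (n : nat) (D : R) (j : nat -> job R n)
    (o : nat -> option 'I_n) (i : 'I_n) (t : R) (h k : nat) :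
  (h < k)%N -> i \in compat (j h) -> t - D <= arrival (j h) ->
  rhat D (hist j o k) (j k) i t <= rhat D (hist j o h) (j h) i t.
Proof.
move=> hk ih tD; rewrite !rhat_hist [leRHS]big_seq_cond.
apply: le_bigmin => [|l /andP[]].
  by apply: ge_bigmin_seq; rewrite ?mem_iota ?ih.
rewrite mem_iota => /andP[_ lh] il; apply: ge_bigmin_seq => //.
by rewrite mem_iota (ltn_trans _ hk).
Qed.

(** * Charging losses and the reward bound *)

(** Here [o] is the algorithm and [a] the comparison assignment. Losses along [a] are spread over
    earlier jobs of [o] ([loss_le]); after exchanging the sums, [charge] bounds what each such job
    receives. *)
Lemma server_bound (R : realType) (n : nat) (delta D eta beta : R)
    (c : 'I_n -> nat) (j : nat -> job R n) (o a : nat -> option 'I_n) (m : nat)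
    (i : 'I_n) : 0 <= eta -> 1 < beta -> (0 < c i)%N ->
  bounded_jobs delta D j m ->
  (forall k, (k < m)%N -> o k = Some i -> i \in compat (j k)) ->
  feasible c (hist j a m) ->
  \sum_(0 <= k < m | a k == Some i) ts_loss D eta beta c (hist j o k) (j k) i <=
  (c i)%:R * (beta `^ (c i)%:R^-1 - 1) *
    (2 * \sum_(0 <= h < m | o h == Some i)
      (ts_loss D eta beta c (hist j o h) (j h) i +
       eta * (rate (j h) i * (dur (j h) i + 1)))).
Proof.
move=> eta0 beta1 c0 [arr0 arrle jdur jrate] ocompat [acompat acap].
have acompati k : (k < m)%N -> a k = Some i -> i \in compat (j k).
  move=> km ak; have /all_filterP := acompat.
  move: acompat; rewrite /hist all_map => /allP/(_ k).
  by rewrite mem_iota/= ak => /(_ km).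
have beta_gt0 := lt_trans ltr01 beta1.
have durP k l : (k < m)%N -> l \in compat (j k) -> 0 < rate (j k) l /\ 1 <= dur (j k) l.
  by move=> km /(jdur k l km)[? /andP[]].
have Psi_eta_ge0 k t : 0 <= Psi eta beta (alpha c (hist j o k) i t) + eta.
  by rewrite /Psi mulrBr mulr1 subrK mulr_ge0// powR_ge0.
have /choice[sch schP] k := ts_loss_max D eta beta c (hist j o k) (j k) i.
pose kappa := (c i)%:R * (beta `^ (c i)%:R^-1 - 1).
have kappa0 : 0 <= kappa.
  by rewrite mulr_ge0// subr_ge0 -[leLHS](powRr0 beta) ler_powR// ltW.
pose g h t := rhat D (hist j o h) (j h) i t *
  (Psi eta beta (alpha c (hist j o h) i t) + eta).
pose e h := arrival (j h) + dur (j h) i.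
have loss_le k : (k < m)%N ->
    (c i)%:R * ts_loss D eta beta c (hist j o k) (j k) i <=
    kappa * \sum_(0 <= h < m | (o h == Some i) && (h < k)%N)
      \sum_(t <- sch k | t < e h) g h t.
  move=> km; have [/andP[_ /allP sk] -> _] := schP k.
  rewrite /schedule_value.
  under eq_bigr do rewrite alpha_hist (Psi_telescope _ _ _ _ beta_gt0).
  rewrite mulr_sumr.
  under eq_bigr do rewrite mulrCA [(c i)%:R * _]mulrA -/kappa mulrCA.
  rewrite -mulr_sumr; apply: ler_wpM2l => //.
  rewrite [leRHS](_ : _ = \sum_(0 <= h < k | o h == Some i) \sum_(t <- sch k)
    (if t < e h then g h t else 0)); last first.
    rewrite [RHS](big_nat_widen _ _ _ _ _ (ltnW km)).
    by apply: eq_bigr => h _; rewrite big_mkcond.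
  rewrite exchange_big/= big_seq [leRHS]big_seq; apply: ler_sum => t /sk /andP[tk _].
  rewrite -[leRHS]big_mkcondr/= [leRHS](eq_bigl (occupies j o i t))// mulr_sumr.
  rewrite [leLHS]big_nat_cond [leRHS]big_nat_cond; apply: ler_sum => h.
  move=> /and3P[/andP[_ hk] /eqP oh te]; rewrite -alpha_hist.
  have hm := ltn_trans hk km; have ih := ocompat h hm oh.
  (* [t] precedes the end of [h], whose duration is at most [D], so [h] lies in the window of the
     minimum at [t]. *)
  have [_ /andP[_ dD]] := jdur h i hm ih.
  rewrite ler_wpM2r//; apply: rhat_hist_le => //.
  by rewrite lerBlDr (le_trans (ltW te))// lerD2l.
have charge h : (h < m)%N -> o h = Some i ->
    \sum_(0 <= k < m | (a k == Some i) && (h < k)%N)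
      \sum_(t <- sch k | t < e h) g h t <=
    (2 * c i)%:R * (ts_loss D eta beta c (hist j o h) (j h) i +
       eta * (rate (j h) i * (dur (j h) i + 1))).
  move=> hm oh; rewrite -big_filter.
  set s := [seq k <- _ | _].
  have ms k : k \in s -> [/\ a k = Some i, (h < k)%N & (k < m)%N].
    by rewrite mem_filter mem_index_iota => /andP[/andP[/eqP ak hk] km].
  have [r0 d1] := durP h i hm (ocompat h hm oh).
  (* With [h] fixed, the price [g h] no longer depends on [k], and the cut at [e h] confines the
     schedules to the duration of [h]. *)
  apply: (packing (a := fun k => arrival (j k))
    (b := fun k => arrival (j k) + dur (j k) i) (T1 := arrival (j h))).
  - rewrite sorted_pairwise; last by move=> x y z; exact: le_trans.
    apply: (@sub_in_pairwise _ (mem s) leq); last 2 first.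
    + exact/allP.
    + rewrite -sorted_pairwise; last exact: leq_trans.
      by rewrite sorted_filter ?iota_sorted//; exact: leq_trans.
    + by move=> x y _ /ms[_ _ ym] xy; exact: arrle.
  - move=> k /ms[ak _ km]; split; first exact: arr0.
    by rewrite lerD2l; have [] := durP k i km (acompati k km ak).
  - move=> t t0; apply: leq_trans (acap i t t0).
    rewrite count_filter count_map /index_iota subn0; apply: sub_count => k /=.
    by rewrite /active/= => /and3P[/andP[-> ->] -> _].
  - move=> k /ms[ak hk km]; split; last by have [] := schP k.
    by apply: arrle => //; exact: ltnW.
  - move=> s' ss'; apply: schedule_shifted_value_le => //; first exact: ltW.
    exact: le_trans d1.
have cR0 : 0 < (c i)%:R :> R by rewrite ltr0n.
(* Multiplying by [c i] gives the left side the form of [loss_le] and supplies the factor [2 * c i]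
   of [charge] on the right. *)
rewrite -(ler_pM2l cR0) mulr_sumr.
apply: le_trans (_ : _ <= \sum_(0 <= k < m | a k == Some i) kappa *
    \sum_(0 <= h < m | (o h == Some i) && (h < k)%N)
      \sum_(t <- sch k | t < e h) g h t) _.
  rewrite [leLHS]big_nat_cond [leRHS]big_nat_cond; apply: ler_sum => k.
  by move=> /andP[/andP[_ km] _]; exact: loss_le.
rewrite -mulr_sumr -/kappa mulrCA ler_wpM2l//.
rewrite (exchange_big_dep (fun h => o h == Some i))/=; last by move=> k h _ /andP[].
rewrite mulrA -natrM [(c i * 2)%N]mulnC mulr_sumr.
rewrite [leLHS]big_nat_cond [leRHS]big_nat_cond; apply: ler_sum => h.
move=> /andP[/andP[_ hm] /eqP oh]; rewrite oh eqxx; exact: charge.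
Qed.

Lemma sum_by_server (R : realType) (n : nat) (a : nat -> option 'I_n) (m : nat)
    (f : nat -> 'I_n -> R) :
  \sum_(0 <= k < m) (if a k is Some i then f k i else 0) =
  \sum_i \sum_(0 <= k < m | a k == Some i) f k i.
Proof.
under [RHS]eq_bigr do rewrite big_mkcond.
rewrite exchange_big/=; apply: eq_bigr => k _; rewrite -big_mkcond.
case: (a k) => [i|]; last by rewrite big_pred0.
by rewrite (big_pred1 i)// => l; rewrite eq_sym.
Qed.

Lemma reward_hist (R : realType) (n : nat) (j : nat -> job R n)
    (o : nat -> option 'I_n) (m : nat) :
  reward (hist j o m) =
  \sum_(0 <= k < m) if o k is Some i then rate (j k) i * dur (j k) i else 0.
Proof. by rewrite /reward big_map /index_iota subn0. Qed.

Lemma balance_reward_ge (R : realType) (n : nat) (delta D eta beta K : R)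
    (c : 'I_n -> nat) (j : nat -> job R n) (o a : nat -> option 'I_n) (m : nat) :
  0 <= eta -> 1 < beta -> (forall i, (0 < c i)%N) ->
  (forall i, (c i)%:R * (beta `^ (c i)%:R^-1 - 1) <= K) ->
  bounded_jobs delta D j m ->
  (forall k, (k < m)%N ->
     balance_choice (ts_loss D eta beta c (hist j o k) (j k)) (j k) (o k)) ->
  feasible c (hist j a m) ->
  reward (hist j a m) <= (1 + 2 * K * (1 + 2 * eta)) * reward (hist j o m).
Proof.
move=> eta0 beta1 c0 cK jb bal afeas.
have [_ _ jdur _] := jb; have [acompat _] := afeas.
have ocompat k i : (k < m)%N -> o k = Some i -> i \in compat (j k).
  by move=> km ok; have := bal k km; rewrite ok => -[].
have acompati k i : (k < m)%N -> a k = Some i -> i \in compat (j k).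
  move: acompat; rewrite /hist all_map => /allP/(_ k) + km ak.
  by rewrite mem_iota/= ak => /(_ km).
pose L k := ts_loss D eta beta c (hist j o k) (j k).
pose V k i := rate (j k) i * dur (j k) i.
pose W k i := L k i + eta * (rate (j k) i * (dur (j k) i + 1)).
have W0 k i : (k < m)%N -> o k = Some i -> 0 <= W k i.
  move=> km ok; have [r0 /andP[d1 _]] := jdur k i km (ocompat k i km ok).
  have d0 : 0 <= dur (j k) i by exact: le_trans d1.
  by rewrite addr_ge0 ?ts_loss_ge0// !mulr_ge0 ?addr_ge0// ltW.
(* The algorithm maximises the net value, with rejection counting as 0, so its net value on [k]
   dominates that of the choice [a k]. *)
have dual_bound : reward (hist j a m) <=
    \sum_(0 <= k < m) (if o k is Some i then V k i - L k i else 0) +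
    \sum_i \sum_(0 <= k < m | a k == Some i) L k i.
  rewrite reward_hist -sum_by_server -big_split/=.
  rewrite big_nat_cond [leRHS]big_nat_cond; apply: ler_sum => k /andP[/andP[_ km] _].
  have := bal k km; have := acompati k.
  case: (a k) => [i /(_ _ km erefl) ik|_].
    rewrite -lerBlDr.
    by case: (o k) => [l [_ _ /(_ i ik)]|/(_ i ik)].
  by case: (o k) => [l [_ /ltW + _]|_]; rewrite addr0.
have loss_bound : \sum_i \sum_(0 <= k < m | a k == Some i) L k i <=
    \sum_(0 <= k < m) (if o k is Some i then 2 * K * W k i else 0).
  rewrite sum_by_server; apply: ler_sum => i _.
  apply: le_trans (server_bound eta0 beta1 (c0 i) jb _ afeas) _.
    by move=> k km; exact: ocompat.
  rewrite -mulr_sumr -/(L _ _) mulrCA -mulrA ler_wpM2l// ler_wpM2r//.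
  by rewrite big_nat_cond sumr_ge0// => k /andP[/andP[_ km] /eqP]; exact: W0.
apply: le_trans dual_bound _; apply: le_trans (lerD (lexx _) loss_bound) _.
rewrite reward_hist mulr_sumr -big_split/=.
rewrite big_nat_cond [leRHS]big_nat_cond; apply: ler_sum => k /andP[/andP[_ km] _].
have := bal k km; have := ocompat k.
case: (o k) => [i /(_ _ km erefl) ik|_ _]; last by rewrite mulr0 addr0.
move=> [_ LV _]; have [r0 /andP[d1 _]] := jdur k i km ik.
have L0 : 0 <= L k i by exact: ts_loss_ge0.
have K0 : 0 <= K.
  apply: le_trans (cK i); rewrite mulr_ge0// subr_ge0 -[leLHS](powRr0 beta).
  by rewrite ler_powR// ltW.
(* An accepted job has loss below its reward, and [dur >= 1] gives [dur + 1 <= 2 * dur]. *)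
have WV : W k i <= (1 + 2 * eta) * V k i.
  rewrite mulrDl mul1r lerD//; first by rewrite -subr_ge0 ltW.
  rewrite [2 * eta]mulrC -mulrA ler_wpM2l// /V mulrCA ler_wpM2l// ?(ltW r0)//; lra.
apply: le_trans (_ : _ <= V k i + 2 * K * ((1 + 2 * eta) * V k i)) _.
  by rewrite lerD ?gerBl// ler_wpM2l// mulr_ge0.
by rewrite -/(V k i) [leRHS]mulrDl mul1r !mulrA.
Qed.

(** * Feasibility *)

(* The one-point schedule at the arrival time already has a loss of at least
   [rate * D] on a full server. *)
Lemma balance_feasible (R : realType) (n : nat) (delta D eta beta : R)
    (c : 'I_n -> nat) (j : nat -> job R n) (o : nat -> option 'I_n) (m : nat) :
  0 < delta -> 0 <= D -> 0 <= eta -> 1 < beta -> delta * D <= eta * (beta - 1) ->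
  (forall i, (0 < c i)%N) ->
  bounded_jobs delta D j m ->
  (forall k, (k < m)%N ->
     balance_choice (ts_loss D eta beta c (hist j o k) (j k)) (j k) (o k)) ->
  feasible c (hist j o m).
Proof.
move=> delta0 D0 eta0 beta1 etabeta c0 [_ arrle jdur jrate] bal.
have not_full k i : (k < m)%N -> o k = Some i ->
    (count (occupies j o i (arrival (j k))) (iota 0 k) < c i)%N.
  move=> km ok; have := bal k km; rewrite ok => -[ik + _].
  have [r0 /andP[d1 dD]] := jdur k i km ik.
  rewrite ltNge; apply: contraNltn => full.
  rewrite subr_le0; pose s := [:: arrival (j k)].
  have ss : reuse_schedule (arrival (j k)) (arrival (j k) + dur (j k) i) s.
    by rewrite /reuse_schedule/= lexx ltrDl (lt_le_trans _ d1).
  apply: le_trans (schedule_value_le_loss D eta beta c (hist j o k) ss).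
  rewrite /schedule_value big_seq1 alpha_hist.
  (* On a full server the exponent of [beta] is at least 1. *)
  have Psi_ge : delta * D <=
      Psi eta beta (1 - (count (occupies j o i (arrival (j k))) (iota 0 k))%:R / (c i)%:R).
    rewrite /Psi subKr (le_trans etabeta)// ler_wpM2l// lerD2r.
    rewrite -[leLHS]powRr1 ?(le_trans _ (ltW beta1))// ler_powR ?(ltW beta1)//.
    by rewrite ler_pdivlMr ?ltr0n// mul1r ler_nat.
  have rhat_ge : rate (j k) i / delta <= rhat D (hist j o k) (j k) i (arrival (j k)).
    have rate_ge h : (h <= k)%N -> i \in compat (j h) ->
        arrival (j k) - D <= arrival (j h) -> rate (j k) i / delta <= rate (j h) i.
      by move=> hk ih hD; rewrite ler_pdivrMr// mulrC; exact: jrate.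
    rewrite rhat_hist big_seq_cond; apply: le_bigmin => [|h].
      by apply: rate_ge => //; rewrite gerBl.
    rewrite mem_iota => /and3P[/andP[_ hk] ih hD].
    by apply: rate_ge => //; exact: ltnW.
  apply: le_trans (ler_pM _ _ rhat_ge Psi_ge).
  - rewrite mulrA divfK ?gt_eqF// ler_wpM2l// ltW//.
  - by rewrite divr_ge0// ltW.
  - by rewrite mulr_ge0// ltW.
split.
  rewrite /hist all_map; apply/allP => k; rewrite mem_iota/= => /(bal k).
  by case: (o k) => // i [].
(* Induction on the prefix length. If the new job is active at [t], all earlier jobs active at [t]
   still occupy the server at its arrival, where [not_full] leaves a free unit. *)
move=> i t _; elim: {-2}m (leqnn m) => [//|k IH] km.
rewrite /hist -addn1 iotaD add0n map_cat count_cat /= addn0 -/(hist j o k).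
case: (boolP (active i t _)) => [|_]; last by rewrite addn0 IH// ltnW.
rewrite /active/= => /andP[/eqP ok /andP[kt _]]; rewrite addn1.
apply: leq_ltn_trans (not_full k i km ok); rewrite count_map.
apply: sub_count => h /=; rewrite /occupies => /andP[-> /andP[_ te]] /=.
exact: le_lt_trans te.
Qed.

(** * Runs and instances in indexed form *)

Lemma run_hist (R : realType) (n : nat) (f : rule R) (c : 'I_n -> nat)
    (j0 : job R n) (I : instance R n) :
  run f c I = hist (nth j0 I)
    (fun k => f n c (run f c (take k I)) (nth j0 I k)) (size I).
Proof.
elim/last_ind: I => [//|I x IH].
rewrite {1}/run foldl_rcons -/(run f c I) {1}IH /hist size_rcons -addn1 iotaD.
rewrite map_cat/= cats1 add0n nth_rcons ltnn eqxx -[in RHS](cats1 I) take_size_cat//.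
congr rcons; apply/eq_in_map => k; rewrite mem_iota add0n => /andP[_ kI].
by rewrite nth_cat kI takel_cat// ltnW.
Qed.

Lemma zip_hist (R : realType) (n : nat) (j0 : job R n) (I : instance R n)
    (a : seq (option 'I_n)) : size a = size I ->
  zip I a = hist (nth j0 I) (nth None a) (size I).
Proof.
move=> sa; apply: (@eq_from_nth _ (j0, None)).
  by rewrite size_zip sa minnn size_map size_iota.
move=> k; rewrite size_zip sa minnn => kI.
by rewrite nth_zip// (nth_map 0%N) ?size_iota// nth_iota.
Qed.

Lemma instance_bounded_jobs (R : realType) (n : nat) (delta D : R) (j0 : job R n)
    (I : instance R n) :
  instances delta D I -> bounded_jobs delta D (nth j0 I) (size I).
Proof.
move=> [/and3P[/(all_nthP j0) arr0 Isorted /(all_nthP j0) Ipos]].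
move=> /andP[/(all_nthP j0) Idur /(all_nthP j0) Irate].
have arrle h k : (h <= k)%N -> (k < size I)%N ->
    arrival (nth j0 I h) <= arrival (nth j0 I k).
  move=> hk kI; have hI := leq_ltn_trans hk kI.
  rewrite -!(nth_map j0 0)//.
  by apply: (sorted_leq_nth le_trans lexx) => //; rewrite inE size_map.
have pos k i : (k < size I)%N -> i \in compat (nth j0 I k) ->
    0 < rate (nth j0 I k) i.
  by move=> /Ipos/forallP/(_ i)/implyP ipos /ipos/andP[].
split=> //.
- move=> k i kI ik; split; first exact: pos.
  by have /forallP/(_ i)/implyP := Idur k kI; apply.
move=> h k i hk kI ih ik hD; have hI := leq_ltn_trans hk kI.
have /(all_nthP j0)/(_ h hI)/implyP := Irate k kI; have := arrle h k hk kI.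
rewrite -subr_ge0 => /ger0_norm ->; rewrite lerBlDl -lerBlDr hD.
move=> /(_ isT)/forallP/(_ i)/implyP; rewrite inE ik ih => /(_ isT)/andP[_].
by rewrite ler_pdivrMr ?pos.
Qed.

Lemma ts_bal_run (R : realType) (D eta beta : R) (A : online_algorithm R)
    (n : nat) (c : 'I_n -> nat) (j0 : job R n) (I : instance R n) (w : seed A) :
  ts_bal D eta beta A ->
  exists2 o, run (act w) c I = hist (nth j0 I) o (size I) &
    forall k, (k < size I)%N ->
      balance_choice (ts_loss D eta beta c (hist (nth j0 I) o k) (nth j0 I k))
        (nth j0 I k) (o k).
Proof.
move=> tsA; eexists; first exact: run_hist.
move=> k kI; rewrite (_ : hist _ _ k = run (act w) c (take k I)); first exact: tsA.
rewrite (run_hist _ _ j0) size_takel ?(ltnW kI)//; apply/eq_in_map => h.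
rewrite mem_iota add0n => /andP[_ hk].
by rewrite nth_take// take_takel// ltnW.
Qed.

(** * Expectation, large capacities and choice of parameters *)

(** Measurability of [f] is not assumed, so the integrals are compared as suprema over simple
    functions: one lying below [r] lies below [f]. *)
Lemma integral_ge_cst (d : measure_display) (T : measurableType d) (R : realType)
    (P : probability T R) (f : T -> R) (r : R) :
  0 <= r -> (forall x, r <= f x) -> (r%:E <= \int[P]_x (f x)%:E)%E.
Proof.
move=> r0 rf; have -> : r%:E = (\int[P]_x r%:E)%E.
  rewrite integral_cst// -[LHS]mule1; congr (_ * _)%E.
  exact/esym/probability_setT.
rewrite !ge0_integralTE//; last by move=> x; rewrite lee_fin (le_trans r0).
apply: le_ereal_sup => _ [h hr <-]; exists h => // x.
by apply: le_trans (hr x) _; rewrite lee_fin.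
Qed.

(** With [b = ln beta] and [y = b / c], [expR y * (1 - y) <= 1] bounds the left side by
    [b / (1 - y)], which is at most [b + 1] once [(b + 1) * y <= 1]; this is the assumption on
    [c]. *)
Lemma powR_root_bound (R : realType) (beta : R) (c : nat) :
  1 < beta -> (ln beta + 1) * ln beta <= c%:R ->
  c%:R * (beta `^ c%:R^-1 - 1) <= ln beta + 1.
Proof.
move=> beta1; set b := ln beta => bc.
have b0 : 0 < b by rewrite ln_gt0.
have c0 : 0 < c%:R :> R by apply: lt_le_trans bc; rewrite mulr_gt0// addr_gt0.
rewrite /powR gt_eqF ?(lt_trans ltr01)// -/b.
set y := c%:R^-1 * b.
have cy : c%:R * y = b by rewrite /y mulrA divff ?gt_eqF// mul1r.
have y1 : (b + 1) * y <= 1 by rewrite /y mulrCA mulrC ler_pdivrMr// mul1r.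
have ey : expR y * (1 - y) <= 1.
  rewrite -[leRHS]expR0 -(subrr y) expRD ler_wpM2l ?expR_ge0//.
  exact: expR_ge1Dx.
have y0 : 0 < y by rewrite mulr_gt0// invr_gt0.
have {}y1 : 0 < 1 - y /\ b <= (b + 1) * (1 - y) by split; nra.
rewrite -(ler_pM2r y1.1) (le_trans _ y1.2)// -[leRHS]cy -mulrA ler_pM2l//; nra.
Qed.

Lemma parameters_exist (R : realType) :
  exists C : R, forall delta D : R, 1 <= delta -> 1 <= D ->
  exists eta beta : R, [/\ 0 < eta, 1 < beta, delta * D = eta * (beta - 1) &
    1 + 2 * (ln beta + 1) * (1 + 2 * eta) <= Gamma C delta D].
Proof.
(* In the small regime [ln X <= 2 * ln M < 2 * (e - 1)], so [B] bounds [1 + X]. *)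
pose B : R := 1 + expR (2 * (expR 1 - 1)).
have lnB : 0 <= ln B by rewrite ln_ge0// lerDl expR_ge0.
(* The small regime needs [7 + 6 * ln B] and the large one 19; this covers both. *)
exists (23 + 6 * ln B) => delta D delta1 D1; rewrite /Gamma.
set M := Num.max delta D; set X := delta * D.
have delta0 : 0 < delta by exact: lt_le_trans delta1.
have D0 : 0 < D by exact: lt_le_trans D1.
have X1 : 1 <= X by rewrite mulr_ege1.
have X0 : 0 < X by exact: lt_le_trans X1.
have M1 : 1 <= M by rewrite le_max delta1.
have M0 : 0 < M by exact: lt_le_trans M1.
have lnX2 : ln X <= 2 * ln M.
  rewrite lnM ?posrE// mulr_natl mulr2n lerD// ler_ln ?posrE// le_max lexx ?orbT//.
case: ifPn => [large|]; last first.
  rewrite -ltNge => small; exists 1, (1 + X).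
  rewrite ltrDl X0 mul1r addrAC subrr add0r; split=> //.
  suff : ln (1 + X) <= ln B by lra.
  rewrite ler_ln ?posrE ?addr_gt0 ?expR_gt0// lerD2l -[leLHS]lnK ?posrE//.
  by rewrite ler_expR; lra.
set lm := ln M in large lnX2 *; set l := ln X in lnX2 *.
have e2 : 2 <= expR 1 :> R by apply: le_trans (expR_ge1Dx 1); lra.
have lm1 : 1 <= lm by apply: le_trans large; lra.
have lml : lm <= l.
  rewrite ler_ln ?posrE// /M ge_max ler_peMr ?ler_peMl// ?ltW//.
have l1 := le_trans lm1 lml.
have l0 : 0 < l by exact: lt_le_trans l1.
(* [beta] is forced by [eta * (beta - 1) = X]. This [eta] keeps [eta * (ln beta + 1)] at most 3
   ([bl]), while [ln beta] exceeds [ln X + ln (ln X)] by at most a constant. *)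
exists l^-1, (1 + X * l).
have Xl1 : 1 <= X * l by rewrite mulr_ege1.
have Xl0 : 0 < X * l by exact: lt_le_trans Xl1.
split; first by rewrite invr_gt0.
- by rewrite ltrDl.
- by rewrite addrAC subrr add0r mulrC mulfK// gt_eqF.
set b := ln _.
have ln2 : ln 2 <= 1 :> R by rewrite -[leRHS]expRK ler_ln ?posrE ?expR_gt0.
have b_le : b <= ln 2 + (l + ln l).
  rewrite -!lnM ?posrE// ler_ln ?posrE ?addr_gt0 ?mulr_gt0//; lra.
(* Passes from [ln (ln X)] to [ln (ln M)], using [ln X <= 2 * ln M]. *)
have lnl_lm : ln l <= ln 2 + ln lm.
  by rewrite -lnM ?posrE ?ler_ln ?posrE// ?mulr_gt0// (lt_le_trans _ lm1).
have lnl : ln l <= l - 1.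
  have := @le_ln1Dx R (l - 1); rewrite [1 + _]addrC subrK; apply; lra.
have bl : (b + 1) * l^-1 <= 3 by rewrite ler_pdivrMr//; lra.
rewrite [X in X <= _](_ : _ = 3 + 2 * b + 4 * ((b + 1) * l^-1)); first lra.
by ring.
Qed.

Lemma opt_ge0 (R : realType) (n : nat) (c : 'I_n -> nat) (I : instance R n) :
  0 <= opt c I.
Proof. exact: bigmax_ge_id. Qed.

Lemma ratio_le (R : realType) (x G : R) (E : \bar R) :
  0 < x -> 0 < G -> ((x / G)%:E <= E)%E -> (x%:E / E <= G%:E)%E.
Proof.
move=> x0 G0; case: E => [e| |//]; last by move=> _; rewrite invey mule0 lee_fin ltW.
rewrite lee_fin => xe; have e0 : 0 < e by rewrite (lt_le_trans _ xe)// divr_gt0.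
by rewrite inver gt_eqF// -EFinM lee_fin ler_pdivrMr// mulrC -ler_pdivrMr.
Qed.

Theorem theorem1 (R : realType) :
  exists C : R, forall delta D : R, 1 <= delta -> 1 <= D ->
  exists eta beta : R, [/\ 0 < eta, 1 < beta &
    forall A : online_algorithm R, ts_bal D eta beta A ->
      feasible_policy delta D A /\
      asymptotically_competitive delta D (Gamma C delta D) A].
Proof.
have [C paramC] := parameters_exist R; exists C => delta D delta1 D1.
have [eta [beta [eta0 beta1 etabeta GammaC]]] := paramC delta D delta1 D1.
exists eta, beta; split=> // A tsA.
have delta0 : 0 < delta by exact: lt_le_trans delta1.
have D0 : 0 <= D by exact: le_trans D1.
pose j0 n : job R n := Job 0 finset.set0 (fun=> 0) (fun=> 0).
split.
  move=> n c c1 I II w; have [dec -> bal] := ts_bal_run c (j0 n) I w tsA.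
  apply: balance_feasible delta0 D0 (ltW eta0) beta1 _ c1 _ bal.
    by rewrite etabeta.
  exact: instance_bounded_jobs.
set K := ln beta + 1; set G := 1 + 2 * K * (1 + 2 * eta) in GammaC *.
have G0 : 0 < G.
  have := ln_gt0 beta1 => b0.
  by rewrite addr_gt0// !mulr_gt0// addr_gt0// mulr_gt0.
rewrite /asymptotically_competitive.
apply: (@le_trans _ _ G%:E); last by rewrite lee_fin.
(* From this capacity on [powR_root_bound] applies, and the infimum defining the upper limit is
   bounded by its value at [c0]. *)
pose c0 := (Num.truncn ((ln beta + 1) * ln beta)).+1.
apply: ereal_inf_le; eexists; first by exists c0.
apply: ge_ereal_sup => _ [[n c] /= cc0 <-]; rewrite /worst_ratio.
apply: ge_ereal_sup => _ [I [II opt0] <-].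
have optpos : 0 < opt c I by rewrite lt_neqAle eq_sym opt0 opt_ge0.
apply: ratio_le => //; apply: integral_ge_cst => [|w].
  by rewrite divr_ge0// ltW.
rewrite ler_pdivrMr// mulrC.
have c1 i : (0 < c i)%N by exact: leq_trans (cc0 i).
have cK i : (c i)%:R * (beta `^ (c i)%:R^-1 - 1) <= K.
  apply: powR_root_bound => //; apply/ltW/(lt_le_trans (truncnS_gt _)).
  by rewrite ler_nat.
have [dec -> bal] := ts_bal_run c (j0 n) I w tsA.
have G_opt a : feasible c (hist (nth (j0 n) I) a (size I)) ->
    reward (hist (nth (j0 n) I) a (size I)) <=
    G * reward (hist (nth (j0 n) I) dec (size I)).
  exact: balance_reward_ge (ltW eta0) beta1 c1 cK (instance_bounded_jobs (j0 n) II) bal.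
rewrite /opt; apply: bigmax_le => [|a /asboolP]; last first.
  by rewrite (zip_hist (j0 n)) ?size_tuple//; exact: G_opt.
(* The default 0 of the maximum is the reward of rejecting every job, a feasible assignment, so the
   same bound covers it. *)
have := G_opt (fun=> None); rewrite reward_hist big1//; apply.
split; first by rewrite /hist all_map; apply/allP.
move=> i t _; rewrite count_map (eq_count (a2 := pred0)) ?count_pred0//.
Qed.
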